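(* In the setting of the context, let $\sigma_1\ge\cdots\ge\sigma_{2N}$ be the singular values of the random feature matrix $\mathbf\Psi\in\mathbb{R}^{n\times2N}$. Let $S>0$, let $M>0$ be sufficiently large in terms of $d$ and $S$, and let $m\in\mathbb{N}$ satisfy $3M\ln(15M)+1\le m\le 2N$. (1) If $\mathbf\Psi$ is generated by Fourier features with $k_j\in[-S,S]^d$, $1\le j\le N$, then $$\sigma_m\lesssim_{\Omega,d,\{\Lambda_i\}_{i=1}^5,S}\sqrt{nN}\,\exp(-a_{\mathrm F}M^{1/d}\ln M),$$ where one may take $a_{\mathrm F}=3\cdot2^{1-1/d}/(112e)$. (2) If $\mathbf\Psi$ is generated by $\tanh$ features with $k_j\in[-S,S]^d$, $1\le j\le2N$, then $$\sigma_m\lesssim_{\Omega,d,\{\Lambda_i\}_{i=1}^5,S}\sqrt{nN}\,\exp(-a_{\mathrm T}M^{1/d}),$$ where $a_{\mathrm T}=a_{\mathrm T}(d,S)>0$ depends only on $d$ and $S$ (and can be chosen explicitly).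
   Context: $x\lesssim_{\bullet}y$ means $x\le Cy$ with $C$ depending only on the subscripts. $\Omega\subset(-1,1)^d$ is a bounded Lipschitz domain with unit outward normal $\mathbf n$. The operators are $Lu=\sum_{k,l}a_{kl}\partial_{kl}u+\sum_kb_k\partial_ku+cu$ in $\Omega$ and $Bu=g_1\frac{\partial u}{\partial\mathbf n}+g_2u$ on $\partial\Omega$, where $A=(a_{kl})$ is symmetric, $b=(b_1,\dots,b_d)^\top$, and $\|A(x)\|_2\le\Lambda_1$, $|b(x)|\le\Lambda_2$, $|c(x)|\le\Lambda_3$ in $\Omega$, $|g_1|\le\Lambda_4$, $|g_2|\le\Lambda_5$ on $\partial\Omega$, for positive constants $\Lambda_i$ (the bounds holding at the collocation points below). Put $\widetilde L=L$ in $\Omega$ and $\widetilde L=B$ on $\partial\Omega$. Collocation points: $x_1,\dots,x_{n_1}\in\Omega$ and $x_{n_1+1},\dots,x_{n_1+n_2}\in\partial\Omega$ (points where $\mathbf n$ is defined), $n=n_1+n_2>2N$. The random feature matrix is $\mathbf\Psi=(\Psi_{ij})\in\mathbb{R}^{n\times2N}$, $\Psi_{ij}=\widetilde L\psi_j(x_i)$. Fourier features: $\psi_j(x)=\cos(k_j^\top x)$, $\psi_{j+N}(x)=\sin(k_j^\top x)$ for $1\le j\le N$. $\tanh$ features: $\psi_j(x)=\tanh(k_j^\top x+v_j)$ for $1\le j\le2N$, with $v_j\in\mathbb{R}$. *)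

(* Defs.v *)
(* Points of R^d are row vectors. *)
From mathcomp Require Import all_boot all_order all_algebra.
From mathcomp Require Import all_classical all_reals all_analysis.

Set Implicit Arguments.
Unset Strict Implicit.
Unset Printing Implicit Defensive.

Import Order.TTheory GRing.Theory Num.Theory.
Import numFieldNormedType.Exports.

Local Open Scope classical_set_scope.
Local Open Scope ring_scope.

(* The library norm on 'rV[R]_d is the max norm, so the Euclidean structure
   is defined here; on balls and Lipschitz conditions the choice of norm is
   immaterial. *)
Definition dotv (R : realType) (d : nat) (u v : 'rV[R]_d) : R :=
  \sum_(i < d) u 0 i * v 0 i.

Definition norm2 (R : realType) (d : nat) (u : 'rV[R]_d) : R :=
  Num.sqrt (dotv u u).

(* v *m A^T is the row-vector form of the matrix-vector product A v. *)
Definition spectral_norm (R : realType) (d : nat) (A : 'M[R]_d) : R :=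
  sup [set norm2 (v *m A^T) | v in [set v : 'rV[R]_d | norm2 v = 1]].

Definition cube (R : realType) (d : nat) (S : R) : set 'rV[R]_d :=
  [set v : 'rV[R]_d | forall i, - S <= v 0 i <= S].

Definition open_cube (R : realType) (d : nat) (S : R) : set 'rV[R]_d :=
  [set v : 'rV[R]_d | forall i, - S < v 0 i < S].

Definition boundary (R : realType) (d : nat) (Omega : set 'rV[R]_d) :
    set 'rV[R]_d :=
  closure Omega `\` interior Omega.

Definition partial (R : realType) (d : nat) (k : 'I_d) (u : 'rV[R]_d -> R) :
    'rV[R]_d -> R :=
  fun x => 'D_(delta_mx 0 k) u x.

Definition grad (R : realType) (d : nat) (u : 'rV[R]_d -> R) (x : 'rV[R]_d) :
    'rV[R]_d :=
  \row_k partial k u x.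

(* Near x, Omega is the part of space strictly above the graph of gamma, in an
   orthonormal coordinate system whose last axis is e. A function of the first
   d - 1 coordinates is the same as a function on R^d that is constant along
   e, which is how gamma is represented. *)
Definition lipschitz_chart (R : realType) (d : nat) (Omega : set 'rV[R]_d)
    (x e : 'rV[R]_d) (gamma : 'rV[R]_d -> R) : Prop :=
  [/\ norm2 e = 1,
      forall y t, gamma (y + t *: e) = gamma y,
      lipschitz gamma &
      \forall y \near x, Omega y <-> gamma y < dotv y e].

(* A domain is a nonempty connected open set. *)
Definition bounded_lipschitz_domain (R : realType) (d : nat)
    (Omega : set 'rV[R]_d) : Prop :=
  [/\ open Omega, connected Omega, Omega !=set0, bounded_set Omega &
      forall x, boundary Omega x ->
        exists e gamma, lipschitz_chart Omega x e gamma].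

(* The normal is defined at x when the chart is differentiable there. As
   grad gamma is orthogonal to e, the vector grad gamma - e has Euclidean norm
   sqrt (1 + |grad gamma|^2), and it points below the graph, out of Omega. *)
Definition unit_outward_normal (R : realType) (d : nat) (Omega : set 'rV[R]_d)
    (x nu : 'rV[R]_d) : Prop :=
  boundary Omega x /\
  exists e gamma,
    [/\ lipschitz_chart Omega x e gamma,
        differentiable gamma x &
        nu = (Num.sqrt (1 + norm2 (grad gamma x) ^+ 2))^-1
               *: (grad gamma x - e)].

Definition opL (R : realType) (d : nat)
    (A : 'rV[R]_d -> 'M[R]_d) (b : 'rV[R]_d -> 'rV[R]_d) (c : 'rV[R]_d -> R)
    (u : 'rV[R]_d -> R) (x : 'rV[R]_d) : R :=
  \sum_(k < d) \sum_(l < d) A x k l * partial k (partial l u) x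
  + \sum_(k < d) b x 0 k * partial k u x + c x * u x.

Definition opB (R : realType) (d : nat)
    (nu : 'rV[R]_d -> 'rV[R]_d) (g1 g2 : 'rV[R]_d -> R)
    (u : 'rV[R]_d -> R) (x : 'rV[R]_d) : R :=
  g1 x * 'D_(nu x) u x + g2 x * u x.

Definition opLtilde (R : realType) (d : nat) (Omega : set 'rV[R]_d)
    (A : 'rV[R]_d -> 'M[R]_d) (b : 'rV[R]_d -> 'rV[R]_d) (c : 'rV[R]_d -> R)
    (nu : 'rV[R]_d -> 'rV[R]_d) (g1 g2 : 'rV[R]_d -> R)
    (u : 'rV[R]_d -> R) (x : 'rV[R]_d) : R :=
  if x \in Omega then opL A b c u x else opB nu g1 g2 u x.

(* The 2N features are indexed by 'I_(N + N). *)
Definition fourier_features (R : realType) (d N : nat) (k : 'I_N -> 'rV[R]_d)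
    (j : 'I_(N + N)) (x : 'rV[R]_d) : R :=
  match fintype.split j with
  | inl i => cos (dotv (k i) x)
  | inr i => sin (dotv (k i) x)
  end.

Definition tanh (R : realType) (t : R) : R :=
  (expR t - expR (- t)) / (expR t + expR (- t)).

Definition tanh_features (R : realType) (d N : nat)
    (k : 'I_(N + N) -> 'rV[R]_d) (v : 'I_(N + N) -> R)
    (j : 'I_(N + N)) (x : 'rV[R]_d) : R :=
  tanh (dotv (k j) x + v j).

Definition feature_matrix (R : realType) (d n p : nat)
    (Lt : ('rV[R]_d -> R) -> 'rV[R]_d -> R)
    (psi : 'I_p -> 'rV[R]_d -> R) (x : 'I_n -> 'rV[R]_d) : 'M[R]_(n, p) :=
  \matrix_(i, j) Lt (psi j) (x i).

(* sigma 1 >= ... >= sigma (minn n p) are the diagonal entries in a singular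
   value decomposition of Psi; the other values of sigma are irrelevant. *)
Definition singular_values (R : realType) (n p : nat) (Psi : 'M[R]_(n, p))
    (sigma : nat -> R) : Prop :=
  [/\ forall i, (1 <= i <= minn n p)%N -> 0 <= sigma i,
      forall i j, (1 <= i)%N -> (i <= j)%N -> (j <= minn n p)%N ->
        sigma j <= sigma i &
      exists (U : 'M[R]_n) (V : 'M[R]_p),
        [/\ U^T *m U = 1%:M, V^T *m V = 1%:M &
            Psi = U
                  *m (\matrix_(i < n, j < p)
                        (if i == j :> nat then sigma i.+1 else 0))
                  *m V^T]].

(* Main.v *)
Require Import Defs.
From mathcomp Require Import all_boot all_order all_algebra.
From mathcomp Require Import all_classical all_reals all_analysis.
From mathcomp Require Import zify ring lra.

(* Every feature is a ridge function y |-> F (k.y + v), so each entry of Psi is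
   a combination of F, F' and F'' at k_j.x_i + v_j whose coefficients separate
   into 1 + d + d^2 products (function of i) * (function of j). Cut the cube
   [-1, 1]^d into cells so small that |k.(x - centre)| <= 1/8 on each cell.
   Replacing F and its derivatives by their Taylor polynomials of degree < P
   at the centres, and expanding (k.(x - centre))^e into monomials, gives a
   matrix of rank at most (1 + d + d^2) * #cells * P^d, and the error in sigma_m
   is at most the Frobenius norm of the difference as soon as this rank is
   below m. With P of order M^(1/d) the rank is O(M), which is below
   3 M ln (15 M) for large M. Since |F^(q)| <= 1 for cos and sin, the Taylor
   remainder is at most 1 / P!, whence the rate exp (- M^(1/d) ln M); since
   |tanh^(q)| <= 2^q q!, it is O(2^-P) for tanh. *)

Import Order.TTheory GRing.Theory Num.Theory.
Import numFieldNormedType.Exports.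

Local Open Scope classical_set_scope.
Local Open Scope ring_scope.

(** * Low-rank perturbation of singular values *)

Lemma sqr_sum_le (R : realFieldType) (n : nat) (f : 'I_n -> R) :
  (\sum_i f i) ^+ 2 <= n%:R * \sum_i f i ^+ 2.
Proof.
have -> : (\sum_i f i) ^+ 2 = \sum_i \sum_j f i * f j.
  by rewrite expr2 mulr_suml; apply: eq_bigr => i _; rewrite mulr_sumr.
have -> : n%:R * \sum_i f i ^+ 2 = \sum_i \sum_j (f i ^+ 2 + f j ^+ 2) / 2.
  have rowE i : \sum_j (f i ^+ 2 + f j ^+ 2) / 2
              = (n%:R * f i ^+ 2 + \sum_j f j ^+ 2) / 2.
    by rewrite -mulr_suml big_split /= sumr_const card_ord mulr_natl.
  rewrite (eq_bigr _ (fun i _ => rowE i)) -mulr_suml big_split /=.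
  by rewrite -mulr_sumr sumr_const card_ord -mulr_natl; lra.
apply: ler_sum => i _; apply: ler_sum => j _.
have := sqr_ge0 (f i - f j); nra.
Qed.

Lemma rv_mul_tr (R : comPzRingType) (n : nat) (u : 'rV[R]_n) :
  (u *m u^T) 0 0 = \sum_i u 0 i ^+ 2.
Proof. by rewrite mxE; apply: eq_bigr => i _; rewrite mxE expr2. Qed.

(* A nonzero combination of the first m right singular vectors is killed by
   any matrix of rank less than m, while Psi stretches it by at least
   sigma m. *)
Lemma singular_value_le (R : realType) (n p r m : nat) (Psi : 'M[R]_(n, p))
    (sigma : nat -> R) (X : 'M[R]_(n, r)) (Y : 'M[R]_(r, p)) (delta : R) :
  singular_values Psi sigma -> (r < m)%N -> (m <= minn n p)%N ->
  (forall i j, `|Psi i j - (X *m Y) i j| <= delta) ->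
  sigma m <= Num.sqrt (n%:R * p%:R) * delta.
Proof.
move=> [sge0 smono [U [V [UU VV Psidef]]]] rm.
rewrite leq_min => /andP[mn mp] le.
have m0 : (0 < m)%N by case: (m) rm.
have n0 : (0 < n)%N by exact: leq_trans mn.
have p0 : (0 < p)%N by exact: leq_trans mp.
have d0 : 0 <= delta by exact: le_trans (le (Ordinal n0) (Ordinal p0)).
set D := \matrix_(_, _) _ in Psidef.
pose J : 'M[R]_(m, p) := pid_mx m.
have [z [z0 zK]] : exists z : 'rV[R]_m, z != 0 /\ z *m (J *m V^T *m Y^T) = 0.
  have : kermx (J *m V^T *m Y^T) != 0.
    rewrite kermx_eq0 /row_free; apply/eqP => eqr.
    by have := rank_leq_col (J *m V^T *m Y^T); rewrite eqr leqNgt rm.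
  move/rowV0Pn => [z zk z0]; exists z; split => //.
  exact/sub_kermxP.
pose y := z *m J *m V^T.
have JJ : J *m J^T = 1%:M.
  by rewrite /J tr_pid_mx pid_mx_id // pid_mx_1.
have yy : y *m y^T = z *m z^T.
  rewrite /y !trmx_mul trmxK !mulmxA -(mulmxA (z *m J)) VV mulmx1.
  by rewrite -(mulmxA z) JJ mulmx1.
(* As [y] is orthogonal to all rows of [Y], only the small difference [Psi - X *m Y] acts on it. *)
have yE : y *m Psi^T = y *m (Psi - X *m Y)^T.
  rewrite linearB /= mulmxBr trmx_mul mulmxA.
  suff -> : y *m Y^T = 0 by rewrite mul0mx subr0.
  by rewrite /y -!mulmxA mulmxA in zK *; rewrite -zK !mulmxA.
(* [J] keeps the first [m] singular directions. Entry [a] carries [sigma a.+1] because [sigma]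
   counts from 1. *)
have GG : (J *m D^T) *m (J *m D^T)^T = diag_mx (\row_(a < m) sigma a.+1 ^+ 2).
  have GE a i : (J *m D^T) a i = if a == i :> nat then sigma a.+1 else 0.
    rewrite mxE (bigD1 (widen_ord mp a)) //= big1 => [|j ja]; last first.
      rewrite !mxE; case: eqP => [aj|]; rewrite ?mul0r//.
      by case/eqP: ja; apply: val_inj.
    by rewrite !mxE /= eqxx ltn_ord mul1r addr0 eq_sym; case: eqP => // ->.
  apply/matrixP => a b; rewrite mxE (bigD1 (widen_ord mn a)) //= big1 => [|i ia].
    rewrite [in X in _ * X]mxE !GE /= eqxx addr0 !mxE eq_sym.
    have -> : (a == b :> nat) = (a == b) by [].
    by case: eqP => [->|]; rewrite ?mulr0 // mulr1n expr2.
  rewrite GE; case: eqP => [ai|]; rewrite ?mul0r//.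
  by case/eqP: ia; apply: val_inj.
have yPsi : (y *m Psi^T) *m (y *m Psi^T)^T
          = z *m diag_mx (\row_(a < m) sigma a.+1 ^+ 2) *m z^T.
  have -> : y *m Psi^T = z *m (J *m D^T) *m U^T.
    rewrite Psidef !trmx_mul trmxK /y !mulmxA -(mulmxA (z *m J)).
    by rewrite VV mulmx1.
  have -> (w : 'rV[R]_n) : (w *m U^T) *m (w *m U^T)^T = w *m w^T.
    by rewrite trmx_mul trmxK mulmxA -(mulmxA w) UU mulmx1.
  by rewrite (trmx_mul z) -GG !mulmxA.
have zz : 0 < \sum_i z 0 i ^+ 2.
  rewrite lt_neqAle sumr_ge0 ?andbT => [|i _]; last exact: sqr_ge0.
  apply: contra z0 => /eqP/esym/eqP.
  rewrite psumr_eq0 => [/allP h|i _]; last exact: sqr_ge0.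
  apply/eqP/rowP => i; rewrite mxE; apply/eqP; rewrite -(sqrf_eq0 (z 0 i)).
  by apply: h; rewrite mem_index_enum.
have lower : sigma m ^+ 2 * \sum_i z 0 i ^+ 2
    <= ((y *m Psi^T) *m (y *m Psi^T)^T) 0 0.
  rewrite yPsi mxE mulr_sumr; apply: ler_sum => i _.
  rewrite !mxE (bigD1 i) //= big1 ?addr0 => [|j ji]; last first.
    by rewrite !mxE (negbTE ji) mulr0n mulr0.
  rewrite !mxE eqxx mulr1n.
  rewrite [X in _ <= X](_ : _ = sigma i.+1 ^+ 2 * z 0 i ^+ 2); last by ring.
  apply: ler_wpM2r; first exact: sqr_ge0.
  have im : (i.+1 <= m)%N by [].
  have mnp : (m <= minn n p)%N by rewrite leq_min mn.
  have s0 : 0 <= sigma m by apply: sge0; rewrite m0.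
  rewrite ler_pXn2r ?nnegrE ?smono //.
  by apply: le_trans s0 _; apply: smono.
have upper : ((y *m Psi^T) *m (y *m Psi^T)^T) 0 0
    <= n%:R * p%:R * delta ^+ 2 * \sum_i z 0 i ^+ 2.
  rewrite yE rv_mul_tr -(rv_mul_tr _ _ z) -yy (rv_mul_tr _ _ y).
  set S := \sum_i y 0 i ^+ 2.
  rewrite (_ : _ * S = \sum_(i < n) (p%:R * delta ^+ 2 * S)); last first.
    rewrite sumr_const card_ord -mulr_natl; ring.
  apply: ler_sum => i _; rewrite mxE.
  apply: le_trans (sqr_sum_le _ _ _) _; rewrite -mulrA ler_wpM2l //.
  rewrite mulr_sumr; apply: ler_sum => j _.
  rewrite exprMn mulrC ler_wpM2r ?sqr_ge0 //.
  rewrite -real_normK ?num_real // ler_pXn2r ?nnegrE //.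
  by have := le i j; rewrite !mxE.
rewrite -(@ler_pXn2r _ 2) ?nnegrE ?sge0 ?m0 ?leq_min ?mn //; last first.
  by rewrite mulr_ge0.
rewrite exprMn sqr_sqrtr ?mulr_ge0 //.
by rewrite -(ler_pM2r zz); apply: le_trans lower _.
Qed.

(** * Taylor expansion on the line *)

(** By the mean value theorem: [g + f] and [g - f] vanish at 0 and have nonnegative derivatives to
    the right of 0. *)
Lemma ler_norm_derive (R : realType) (f g df dg : R -> R) (h : R) :
  (forall t : R, is_derive t 1 f (df t)) ->
  (forall t : R, is_derive t 1 g (dg t)) ->
  f 0 = 0 -> g 0 = 0 -> (forall t, 0 <= t -> `|df t| <= dg t) -> 0 <= h ->
  `|f h| <= g h.
Proof.
move=> Df Dg f0 g0 le h0.
have aux (u : R -> R) (du : R -> R) : (forall t : R, is_derive t 1 u (du t)) ->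
    u 0 = 0 -> (forall t, 0 <= t -> 0 <= du t) -> 0 <= u h.
  move=> Du u0 du0; move: h0; rewrite le_eqVlt => /predU1P[<-|h0].
    by rewrite u0.
  have [] := @MVT R u du 0 h h0 (fun t _ => Du t).
    by apply: derivable_within_continuous => t _; exact: ex_derive.
  move=> c; rewrite in_itv /= u0 !subr0 => /andP[c0 _] ->.
  by rewrite mulr_ge0 ?du0 // ltW.
rewrite ler_norml; apply/andP; split.
- rewrite -subr_ge0 opprK.
  apply: (aux (f + g) (fun t => df t + dg t)) => [|t t0].
  + by change (f 0 + g 0 = 0); rewrite f0 g0 addr0.
  + by have := le t t0; rewrite ler_norml => /andP[]; lra.
- rewrite -subr_ge0.
  apply: (aux (g - f) (fun t => dg t - df t)) => [|t t0].
  + by change (g 0 - f 0 = 0); rewrite f0 g0 subr0.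
  + by have := le t t0; rewrite ler_norml => /andP[]; lra.
Qed.

Lemma is_derive_affine (R : realType) (f : R -> R) (df a t h : R) :
  is_derive (t + a * h) 1 f df ->
  is_derive h 1 (fun x => f (t + a * x)) (a * df).
Proof.
move=> Df.
have Dg : is_derive h 1 (fun x : R => t + a * x) a.
  have := @is_deriveD _ _ _ (cst t) (a \*: id) h 1 _ _ _ _.
  move=> /(_ _ _ (is_derive_cst _ _ _) (is_deriveZ _ (is_derive_id _ _))).
  by rewrite add0r /GRing.scale /= mulr1.
have -> : a * df = df * a by rewrite mulrC.
exact: (@is_derive1_comp R f (fun x => t + a * x) h df a Df Dg).
Qed.

(** Here [F p] plays the p-th derivative. Induction on [P]: the derivative in [h] of the remainder
    of order [P.+1] is the remainder of order [P] of the shifted tower. *)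
Lemma taylor_remainder_ge0 (R : realType) (F : nat -> R -> R) (B t0 : R)
    (P : nat) :
  (forall p t, is_derive (t : R) 1 (F p) (F p.+1 t)) ->
  (forall t, `|F P t| <= B) ->
  forall h, 0 <= h ->
  `|F 0%N (t0 + h) - \sum_(p < P) F p t0 * (h ^+ p / p`!%:R)|
    <= B * (h ^+ P / P`!%:R).
Proof.
elim: P F => [|P IH] F DF FB h h0.
  by rewrite big_ord0 subr0 expr0 fact0 divr1 mulr1.
have IH' := IH (fun p => F p.+1) (fun p => DF p.+1) FB.
have Dpow (n : nat) (t : R) :
    is_derive t 1 (fun h : R => h ^+ n.+1 / n.+1`!%:R) (t ^+ n / n`!%:R).
  rewrite (_ : (fun _ => _) = n.+1`!%:R^-1 \*: (@id R ^+ n.+1)); last first.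
    by apply/funext => x; rewrite fctE /= mulrC.
  apply: is_derive_eq; rewrite /= /GRing.scale /= mulr1 factS natrM invfM.
  by rewrite mulrACA mulVf ?pnatr_eq0 // mul1r mulrC.
pose f (h : R) := F 0%N (t0 + h) - \sum_(p < P.+1) F p t0 * (h ^+ p / p`!%:R).
pose df (h : R) := F 1%N (t0 + h) - \sum_(p < P) F p.+1 t0 * (h ^+ p / p`!%:R).
pose dg (h : R) := B * (h ^+ P / P`!%:R).
apply: (@ler_norm_derive R f
  (fun h => B * (h ^+ P.+1 / P.+1`!%:R)) df dg) => //.
- move=> t.
  (* The term p = 0 is split off since its derivative vanishes; the factor 1 gives the shape that
     [is_derive_affine] expects. *)
  rewrite (_ : f = (fun h => F 0%N (t0 + 1 * h)) - (cst (F 0%N t0)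
     + \sum_(p < P) (F p.+1 t0 \*: (fun h => h ^+ p.+1 / p.+1`!%:R)))); last first.
    apply/funext => x; rewrite /f !fctE fct_sumE big_ord_recl mul1r.
    by rewrite expr0 fact0 divr1 mulr1.
  rewrite (_ : df t = 1 * F 1%N (t0 + 1 * t)
      - (0 + \sum_(p < P) F p.+1 t0 *: (t ^+ p / p`!%:R))); last first.
    by rewrite !mul1r add0r.
  apply: is_deriveB.
    exact/is_derive_affine.
- rewrite /f big_ord_recl /= addr0 expr0 fact0 divr1 mulr1.
  rewrite big1 ?addr0 ?subrr // => i _.
  by rewrite exprS mul0r mul0r mulr0.
- by rewrite exprS mul0r mul0r mulr0.
Qed.

Lemma taylor_remainder (R : realType) (F : nat -> R -> R) (B t0 h : R)
    (P : nat) :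
  (forall p t, is_derive (t : R) 1 (F p) (F p.+1 t)) ->
  (forall t, `|F P t| <= B) ->
  `|F 0%N (t0 + h) - \sum_(p < P) F p t0 * (h ^+ p / p`!%:R)|
    <= B * (`|h| ^+ P / P`!%:R).
Proof.
move=> DF FB; have [h0|h0] := leP 0 h.
  by rewrite (ger0_norm h0); exact: taylor_remainder_ge0.
(* Reflection makes the increment positive; the signs of the derivatives cancel those of the powers
   of [- h]. *)
pose G p t := (-1) ^+ p * F p (- t).
have DG p (t : R) : is_derive t 1 (G p) (G p.+1 t).
  rewrite (_ : G p = (-1) ^+ p \*: (fun t => F p (0 + -1 * t))); last first.
    by apply/funext => x; rewrite /G /= add0r mulN1r.
  rewrite (_ : G p.+1 t = (-1) ^+ p *: (-1 * F p.+1 (0 + -1 * t))).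
    exact/is_deriveZ/is_derive_affine.
  by rewrite /G add0r mulN1r /GRing.scale /= !mulN1r exprSr mulrN1 mulNr mulrN.
have GB t : `|G P t| <= B by rewrite normrM normrX normrN1 expr1n mul1r.
have := @taylor_remainder_ge0 R G B (- t0) P DG GB (- h).
rewrite oppr_ge0 ltW // => /(_ isT); rewrite (ltr0_norm h0).
rewrite {1}/G expr0 mul1r opprD !opprK.
rewrite (eq_bigr (fun p : 'I_P => F p t0 * (h ^+ p / p`!%:R))) // => p _.
rewrite /G opprK (exprNn h).
have := sqrr_sign R p; set e := (-1) ^+ p; set x := h ^+ p => e2.
transitivity (e ^+ 2 * (F p t0 * (x / p`!%:R))); last by rewrite e2 mul1r.
by ring.
Qed.

(** * Derivatives of all orders of cos, sin and tanh *)

(** Differentiation is a phase shift by pi / 2, so one formula covers all orders and the bound 1 is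
    uniform. *)
Lemma cos_tower_derive (R : realType) (p : nat) (t : R) :
  is_derive t 1 (fun t => cos (t + p%:R * (pi / 2)))
    (cos (t + p.+1%:R * (pi / 2))).
Proof.
rewrite -(natr1 p) (mulrDl p%:R) mul1r addrA cosDpihalf.
have := @is_derive_affine R cos _ 1 (p%:R * (pi / 2)) t (is_derive_cos _).
rewrite !mul1r addrC.
have -> // : (fun x : R => cos (p%:R * (pi / 2) + 1 * x))
        = (fun t => cos (t + p%:R * (pi / 2))).
by apply/funext => x; rewrite mul1r addrC.
Qed.

Lemma sin_tower_derive (R : realType) (p : nat) (t : R) :
  is_derive t 1 (fun t => sin (t + p%:R * (pi / 2)))
    (sin (t + p.+1%:R * (pi / 2))).
Proof.
rewrite -(natr1 p) (mulrDl p%:R) mul1r addrA sinDpihalf.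
have := @is_derive_affine R sin _ 1 (p%:R * (pi / 2)) t (is_derive_sin _).
rewrite !mul1r addrC.
have -> // : (fun x : R => sin (p%:R * (pi / 2) + 1 * x))
        = (fun t => sin (t + p%:R * (pi / 2))).
by apply/funext => x; rewrite mul1r addrC.
Qed.

Lemma normr_tanh_le1 (R : realType) (t : R) : `|tanh t| <= 1.
Proof.
have e1 := expR_gt0 t; have e2 := expR_gt0 (- t).
rewrite /tanh normrM normfV (gtr0_norm (addr_gt0 e1 e2)).
rewrite ler_pdivrMr ?addr_gt0 // mul1r ler_norml; lra.
Qed.

Lemma is_derive_tanh (R : realType) (t : R) :
  is_derive t 1 (@tanh R) (1 - tanh t ^+ 2).
Proof.
have e1 := expR_gt0 t; have e2 := expR_gt0 (- t).
have DN : is_derive t 1 (fun t : R => expR (- t)) (- expR (- t)).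
  have := @is_derive_affine R expR _ (-1) 0 t (is_derive_expR _).
  rewrite add0r !mulN1r.
  have -> // : (fun x : R => expR (0 + -1 * x)) = (fun t => expR (- t)).
  by apply/funext => x; rewrite add0r mulN1r.
have s0 : expR t + expR (- t) != 0 by rewrite gt_eqF ?addr_gt0.
pose f : R -> R := expR - (fun t => expR (- t)).
pose g : R -> R := expR + (fun t => expR (- t)).
have Df : is_derive t 1 f (expR t - - expR (- t)) by exact: is_deriveB.
have Dg : is_derive t 1 g (expR t + - expR (- t)) by exact: is_deriveD.
have g0 : g t != 0 by [].
have -> : @tanh R = f * (fun t => (g t)^-1) by [].
apply: is_derive_eq (is_deriveM Df (is_deriveV g0 Dg)) _.
change (f t * (- g t ^- 2 * (expR t + - expR (- t)))
  + (g t)^-1 * (expR t - - expR (- t)) = 1 - (f t / g t) ^+ 2).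
have -> : f t = expR t - expR (- t) by [].
have -> : g t = expR t + expR (- t) by [].
by field.
Qed.

(** Since tanh' = 1 - tanh^2, the p-th derivative of tanh is this polynomial evaluated at tanh. *)
Fixpoint tanh_poly (R : realType) (p : nat) : {poly R} :=
  if p is p'.+1 then (tanh_poly R p')^`() * (1 - 'X^2) else 'X.

Lemma size_deriv_leq (R : nzSemiRingType) (n : nat) (q : {poly R}) :
  (size q <= n.+1)%N -> (size q^`() <= n)%N.
Proof.
move=> qn; apply/leq_sizeP => j nj; rewrite coef_deriv nth_default ?mul0rn //.
exact: leq_trans qn _.
Qed.

Lemma size_tanh_poly (R : realType) (p : nat) :
  (size (tanh_poly R p) <= p.+2)%N.
Proof.
elim: p => [|p IH] /=; first by rewrite size_polyX.
apply: leq_trans (size_polyMleq _ _) _.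
have -> : size (1 - 'X^2 : {poly R})%R = 3%N.
  by rewrite -opprB size_polyN size_Xn_sub_1.
by rewrite addn3 /= !ltnS; exact: size_deriv_leq.
Qed.

Lemma norm_horner_le (R : realType) (n : nat) (q : {poly R}) (x : R) :
  (size q <= n)%N -> `|x| <= 1 -> `|q.[x]| <= \sum_(i < n) `|q`_i|.
Proof.
move=> qn x1; rewrite (horner_coef_wide _ qn).
apply: le_trans (ler_norm_sum _ _ _) _; apply: ler_sum => i _.
by rewrite normrM normrX ler_piMr // exprn_ile1.
Qed.

(** In the l1 norm of the coefficients, differentiation costs a factor at most [p.+1], the degree
    bound, and multiplication by 1 - X^2 a factor at most 2. *)
Lemma coef_tanh_poly_le (R : realType) (p : nat) :
  \sum_(i < p.+2) `|(tanh_poly R p)`_i| <= 2 ^+ p * p`!%:R.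
Proof.
elim: p => [|p IH].
  by rewrite !big_ord_recr big_ord0 /= !coefX /= normr0 normr1 add0r add0r mulr1.
set q := (tanh_poly R p)^`().
have qs : (size q <= p.+1)%N.
  exact: size_deriv_leq (size_tanh_poly R p).
have qle : \sum_(i < p.+1) `|q`_i| <= p.+1%:R * (2 ^+ p * p`!%:R).
  apply: (@le_trans _ _ (p.+1%:R * \sum_(i < p.+1) `|(tanh_poly R p)`_i.+1|)).
    rewrite mulr_sumr; apply: ler_sum => i _.
    by rewrite coef_deriv normrMn -[_ *+ i.+1]mulr_natl ler_wpM2r // ler_nat.
  rewrite ler_wpM2l //; apply: le_trans IH.
  by rewrite [leRHS]big_ord_recl lerDr.
have -> : tanh_poly R p.+1 = q - q * 'X^2 by rewrite /= mulrBr mulr1.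
apply: (@le_trans _ _ (\sum_(i < p.+3) `|q`_i|
    + \sum_(i < p.+3) `|(q * 'X^2)`_i|)).
  rewrite -big_split; apply: ler_sum => i _; rewrite coefB; exact: ler_normB.
have -> : \sum_(i < p.+3) `|q`_i| = \sum_(i < p.+1) `|q`_i|.
  rewrite 2!big_ord_recr /= !(nth_default 0) ?normr0 ?addr0 //.
  exact: leq_trans qs _.
have -> : \sum_(i < p.+3) `|(q * 'X^2)`_i| = \sum_(i < p.+1) `|q`_i|.
  rewrite 2!big_ord_recl !coefMXn /= normr0 !add0r.
  by apply: eq_bigr => i _; rewrite coefMXn /= subn2.
rewrite exprS factS natrM; lra.
Qed.

Lemma tanh_tower_derive (R : realType) (p : nat) (t : R) :
  is_derive t 1 (fun t => (tanh_poly R p).[tanh t])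
    ((tanh_poly R p.+1).[tanh t]).
Proof.
rewrite /= !hornerE.
exact: (is_derive1_comp (is_derive_poly _ _) (is_derive_tanh _ t)).
Qed.

Lemma tanh_tower_le (R : realType) (p : nat) (t : R) :
  `|(tanh_poly R p).[tanh t]| <= 2 ^+ p * p`!%:R.
Proof.
apply: le_trans (coef_tanh_poly_le R p).
by apply: norm_horner_le; rewrite ?size_tanh_poly ?normr_tanh_le1.
Qed.

(** * Differential operators applied to ridge functions *)

Lemma dotv_shift (R : realType) (d : nat) (k e x : 'rV[R]_d) (h : R) :
  dotv k (h *: e + x) = dotv k e * h + dotv k x.
Proof.
rewrite /dotv mulr_suml -big_split /=; apply: eq_bigr => i _.
by rewrite !mxE mulrDr mulrCA mulrC.
Qed.

(** The difference quotient along [e] is literally that of h |-> f (t + a h) at 0, with a = k.e, so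
    a one-variable derivative suffices. *)
Lemma derive_ridge (R : realType) (d : nat) (f : R -> R) (df v : R)
    (k e x : 'rV[R]_d) :
  is_derive (dotv k x + v) 1 f df ->
  'D_e (fun y => f (dotv k y + v)) x = dotv k e * df.
Proof.
move=> Df; set t := dotv k x + v in Df *; set a := dotv k e.
have Dg : is_derive (0 : R) 1 (fun h => f (t + a * h)) (a * df).
  by have := @is_derive_affine R f df a t 0; rewrite mulr0 addr0; exact.
rewrite -(@derive_val _ _ _ _ _ _ _ Dg) /derive.
pose u (y : 'rV[R]_d) := f (dotv k y + v); pose g (h : R) := f (t + a * h).
suff -> : (fun h : R => h^-1 *: ((u \o shift x) (h *: e) - u x))
        = (fun h : R => h^-1 *: ((g \o shift 0) (h *: 1) - g 0)) by [].
apply/funext => h.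
rewrite /u /g /= dotv_shift -/a -addrA -/t !addr0 mulr0 addr0.
by rewrite /GRing.scale /= mulr1 (addrC (a * h)).
Qed.

Lemma dotv_delta (R : realType) (d : nat) (k : 'rV[R]_d) (i : 'I_d) :
  dotv k (delta_mx 0 i) = k 0 i.
Proof.
rewrite /dotv (bigD1 i) //= big1 => [|j ji]; last first.
  by rewrite mxE eqxx (negbTE ji) mulr0.
by rewrite mxE !eqxx mulr1 addr0.
Qed.

Lemma partial_ridge (R : realType) (d : nat) (F : nat -> R -> R)
    (k : 'rV[R]_d) (v : R)
    (i : 'I_d) (p : nat) :
  (forall p t, is_derive (t : R) 1 (F p) (F p.+1 t)) ->
  partial i (fun y => F p (dotv k y + v))
  = (fun y => k 0 i * F p.+1 (dotv k y + v)).
Proof.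
move=> DF; apply/funext => x.
by rewrite /partial (derive_ridge _ _ _ _ v _ _ _ (DF p _)) dotv_delta.
Qed.

Lemma partial2_ridge (R : realType) (d : nat) (F : nat -> R -> R)
    (k : 'rV[R]_d) (v : R)
    (i j : 'I_d) (x : 'rV[R]_d) :
  (forall p t, is_derive (t : R) 1 (F p) (F p.+1 t)) ->
  partial i (partial j (fun y => F 0%N (dotv k y + v))) x
  = k 0 i * k 0 j * F 2%N (dotv k x + v).
Proof.
move=> DF; rewrite partial_ridge // /partial.
have Df : is_derive (dotv k x + v) 1 (k 0 j \*: F 1%N)
    (k 0 j * F 2%N (dotv k x + v)) by exact: is_deriveZ.
by rewrite (derive_ridge _ _ _ _ _ _ _ _ Df) dotv_delta mulrA.
Qed.

Lemma opL_ridge (R : realType) (d : nat) (F : nat -> R -> R)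
    (k : 'rV[R]_d) (v : R)
    (A : 'rV[R]_d -> 'M[R]_d) (b : 'rV[R]_d -> 'rV[R]_d)
    (c : 'rV[R]_d -> R) (x : 'rV[R]_d) :
  (forall p t, is_derive (t : R) 1 (F p) (F p.+1 t)) ->
  opL A b c (fun y => F 0%N (dotv k y + v)) x =
  \sum_i \sum_j A x i j * (k 0 i * k 0 j * F 2%N (dotv k x + v))
  + \sum_i b x 0 i * (k 0 i * F 1%N (dotv k x + v))
  + c x * F 0%N (dotv k x + v).
Proof.
move=> DF; rewrite /opL; congr (_ + _ + _).
  by apply: eq_bigr => i _; apply: eq_bigr => j _; rewrite partial2_ridge.
by apply: eq_bigr => i _; rewrite partial_ridge.
Qed.

Lemma opB_ridge (R : realType) (d : nat) (F : nat -> R -> R)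
    (k : 'rV[R]_d) (v : R)
    (nu : 'rV[R]_d -> 'rV[R]_d) (g1 g2 : 'rV[R]_d -> R)
    (x : 'rV[R]_d) :
  (forall p t, is_derive (t : R) 1 (F p) (F p.+1 t)) ->
  opB nu g1 g2 (fun y => F 0%N (dotv k y + v)) x =
  \sum_i (g1 x * nu x 0 i) * (k 0 i * F 1%N (dotv k x + v))
  + g2 x * F 0%N (dotv k x + v).
Proof.
move=> DF; rewrite /opB (derive_ridge _ _ _ _ v _ _ _ (DF 0%N _)); congr (_ + _).
rewrite /dotv mulrA mulr_sumr !mulr_suml; apply: eq_bigr => i _.
by ring.
Qed.

(** * Separated expansion on a grid of cells *)

(** The coefficients are independent of [z], which lets a product [z] of row and column data be
    separated. One set of (P + 1)^d exponents serves all powers p <= P. *)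
Lemma expr_sum_multinomial (R : comNzRingType) (d P : nat) :
  exists mu : nat -> {ffun 'I_d -> 'I_P.+1} -> R,
  forall (z : 'I_d -> R) (p : nat), (p <= P)%N ->
    (\sum_i z i) ^+ p = \sum_alpha mu p alpha * \prod_i z i ^+ alpha i.
Proof.
(* The power expands over maps from factors to summands, sorted by fibre sizes; these are at most p
   <= P, so [inord] is exact. *)
pose deg p (f : {ffun 'I_p -> 'I_d}) : {ffun 'I_d -> 'I_P.+1} :=
  [ffun i => inord #|[pred t | f t == i]|].
exists (fun p alpha => #|[pred f | deg p f == alpha]|%:R) => z p pP.
rewrite -[in LHS](card_ord p) -prodr_const bigA_distr_bigA /=.
rewrite (partition_big (deg p) predT) //=; apply: eq_bigr => alpha _.
rewrite mulr_natl -sumr_const; apply: eq_bigr => f /eqP degf.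
rewrite (partition_big f predT) //=; apply: eq_bigr => i _.
rewrite -degf ffunE inordK.
  rewrite -prodr_const; apply: eq_big => t; first by rewrite inE.
  by move=> /eqP ->.
by rewrite ltnS; apply: leq_trans pP; rewrite -[leqRHS]card_ord max_card.
Qed.

Lemma grid_point (R : realType) (Q : nat) (x : R) : `|x| <= 1 ->
  exists t : 'I_Q.+1,
    `|x - (-1 + (2 * t%:R + 1) / Q.+1%:R)| <= Q.+1%:R^-1.
Proof.
rewrite ler_norml => /andP[x1 x2].
set q : R := Q.+1%:R; have q0 : 0 < q by rewrite ltr0n.
have iq : 0 < q^-1 by rewrite invr_gt0.
suff [t [t1 t2]] : exists t : 'I_Q.+1,
    t%:R * 2 <= (x + 1) * q /\ (x + 1) * q <= (t%:R + 1) * 2.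
  exists t.
  have -> : x - (-1 + (2 * t%:R + 1) / q) = ((x + 1) * q - (2 * t%:R + 1)) / q.
    by field; rewrite gt_eqF.
  rewrite normrM (gtr0_norm iq) ler_piMl ?(ltW iq) // ler_norml; lra.
have [xq|xq] := ltP ((x + 1) * q / 2) q.
  have y0 : 0 <= (x + 1) * q / 2.
    by rewrite divr_ge0 // mulr_ge0 ?(ltW q0) //; lra.
  have tq : (Num.trunc ((x + 1) * q / 2) < Q.+1)%N.
    by rewrite Num.Theory.truncn_lt_nat.
  exists (Ordinal tq) => /=.
  have /andP[] := truncn_itv y0; rewrite -(natr1 (Num.trunc _)) => t1 t2.
  by split; lra.
(* Only the right end x = 1 is left, whose truncation would fall one past the last cell. *)
exists ord_max => /=.
have : q = Q%:R + 1 by rewrite natr1.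
by split; nra.
Qed.

(** Each [a] is one separated coefficient with a derivative of order [ord a]. Letting [F] vary with
    the column puts cos and sin into one matrix. *)
Lemma ridge_entry_low_rank (R : realType) (d n p P Q : nat) (S delta : R)
    (G : nat -> R)
    (J : finType) (ord : J -> nat) (U : 'I_n -> J -> R) (W : J -> 'I_p -> R)
    (x : 'I_n -> 'rV[R]_d) (k : 'I_p -> 'rV[R]_d) (v : 'I_p -> R)
    (F : 'I_p -> nat -> R -> R) :
  (forall j q t, is_derive (t : R) 1 (F j q) (F j q.+1 t)) ->
  (forall j q t, `|F j q t| <= G q) ->
  (forall i l, `|x i 0 l| <= 1) -> (forall j, cube S (k j)) ->
  d%:R * S <= 8^-1 * Q.+1%:R ->
  (forall a, G (P.+1 + ord a)%N * (8^-1 ^+ P.+1 / P.+1`!%:R) <= delta) ->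
  exists r (X : 'M[R]_(n, r)) (Y : 'M[R]_(r, p)),
    r = (#|J| * (P.+1 ^ d * Q.+1 ^ d))%N /\
    forall i j,
      `|\sum_a U i a * (W a j * F j (ord a) (dotv (k j) (x i) + v j))
        - (X *m Y) i j| <= (\sum_a `|U i a| * `|W a j|) * delta.
Proof.
move=> DF FG x1 kS dS Gd.
have [mu muE] := expr_sum_multinomial R d P.
have /choice[cell cellP] : forall i, exists q : {ffun 'I_d -> 'I_Q.+1},
    forall l, `|x i 0 l - (-1 + (2 * (q l)%:R + 1) / Q.+1%:R)| <= Q.+1%:R^-1.
  move=> i; have /choice[q qP] := fun l => grid_point R Q (x i 0 l) (x1 i l).
  by exists [ffun l => q l] => l; rewrite ffunE.
pose cen (q : {ffun 'I_d -> 'I_Q.+1}) : 'rV[R]_d :=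
  \row_l (-1 + (2 * (q l)%:R + 1) / Q.+1%:R).
pose y i := x i - cen (cell i).
(* [Z] gathers all that depends on the column once cell and monomial are fixed; [T] is the Taylor
   polynomial at the centre of the cell of [x i]. *)
pose Z a q (alpha : {ffun 'I_d -> 'I_P.+1}) j :=
  \sum_(e < P.+1) F j (e + ord a)%N (dotv (k j) (cen q) + v j) / e`!%:R
    * (mu e alpha * \prod_l k j 0 l ^+ alpha l).
pose T a i j := \sum_(e < P.+1)
  F j (e + ord a)%N (dotv (k j) (cen (cell i)) + v j)
    * (dotv (k j) (y i) ^+ e / e`!%:R).
have TE a i j : T a i j
      = \sum_(alpha : {ffun 'I_d -> 'I_P.+1})
          (\prod_l y i 0 l ^+ alpha l) * Z a (cell i) alpha j.
  under [RHS]eq_bigr => alpha _ do rewrite mulr_sumr.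
  rewrite exchange_big; apply: eq_bigr => e _.
  set f := F j _ _; rewrite [dotv (k j) (y i)]/dotv.
  rewrite (muE (fun l => k j 0 l * y i 0 l) e (ltn_ord e)) mulr_suml mulr_sumr.
  apply: eq_bigr => alpha _.
  have -> : \prod_l (k j 0 l * y i 0 l) ^+ alpha l
      = (\prod_l k j 0 l ^+ alpha l) * \prod_l y i 0 l ^+ alpha l.
    by rewrite -big_split /=; apply: eq_bigr => l _; rewrite exprMn.
  by move: (\prod_l k j 0 l ^+ _) (\prod_l y i 0 l ^+ _) => u w; ring.
(* Each of the d coordinates contributes at most S / (Q + 1). *)
have small i j : `|dotv (k j) (y i)| <= 8^-1.
  apply: (@le_trans _ _ (\sum_(l < d) S * Q.+1%:R^-1)).
    apply: le_trans (ler_norm_sum _ _ _) _; apply: ler_sum => l _.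
    rewrite normrM ler_pM //; first by rewrite ler_norml; apply: kS.
    by rewrite !mxE; apply: cellP.
  rewrite sumr_const card_ord -[_ *+ d]mulr_natl mulrA ler_pdivrMr ?ltr0n //.
have TF a i j : `|F j (ord a) (dotv (k j) (x i) + v j) - T a i j| <= delta.
  have -> : dotv (k j) (x i) + v j
          = (dotv (k j) (cen (cell i)) + v j) + dotv (k j) (y i).
    rewrite addrAC; congr (_ + _); rewrite /dotv -big_split /=.
    apply: eq_bigr => l _; rewrite -mulrDr.
    have -> : y i 0 l = x i 0 l - cen (cell i) 0 l by rewrite !mxE.
    by rewrite [in RHS]addrC subrK.
  have := @taylor_remainder R (fun e => F j (e + ord a)%N) (G (P.+1 + ord a)%N)
    (dotv (k j) (cen (cell i)) + v j) (dotv (k j) (y i)) P.+1.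
  rewrite add0n => H; apply: le_trans (H _ _) _ => //.
  have G0 : 0 <= G (P.+1 + ord a)%N by exact: le_trans (FG j _ 0).
  apply: le_trans (Gd a); rewrite ler_wpM2l // ler_wpM2r ?invr_ge0 //.
  by rewrite lerXn2r ?nnegrE ?invr_ge0.
(* The cell belongs to the inner index and is selected by an indicator in [X], so rows with
   different Taylor centres fit in one product. *)
pose I := (J * ({ffun 'I_d -> 'I_P.+1} * {ffun 'I_d -> 'I_Q.+1}))%type.
pose X i (u : I) :=
  U i u.1 * ((cell i == u.2.2)%:R * \prod_l y i 0 l ^+ u.2.1 l).
pose Y (u : I) j := W u.1 j * Z u.1 u.2.2 u.2.1 j.
pose XM : 'M[R]_(n, #|{: I}|) := \matrix_(i, u) X i (enum_val u).
pose YM : 'M[R]_(#|{: I}|, p) := \matrix_(u, j) Y (enum_val u) j.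
exists #|{: I}|, XM, YM; split.
  by rewrite !card_prod !card_ffun !card_ord.
move=> i j.
have -> : (XM *m YM) i j = \sum_a U i a * (W a j * T a i j).
  rewrite mxE; under eq_bigr => u _ do rewrite !mxE.
  rewrite -(big_enum_val (A := predT) (fun u : I => X i u * Y u j)) /=.
  rewrite -(pair_bigA _ (fun a b => X i (a, b) * Y (a, b) j)) /=.
  apply: eq_bigr => a _.
  rewrite TE -(pair_bigA _ (fun b c => X i (a, (b, c)) * Y (a, (b, c)) j)) /=.
  rewrite !mulr_sumr; apply: eq_bigr => alpha _.
  rewrite (bigD1 (cell i)) //= big1 ?addr0 => [|c cn]; last first.
    by rewrite /X /= eq_sym (negbTE cn) mul0r mulr0 mul0r.
  by rewrite /X /Y /= eqxx mul1r; ring.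
rewrite -sumrB mulr_suml; apply: le_trans (ler_norm_sum _ _ _) _.
apply: ler_sum => a _; rewrite -mulrBr -mulrBr !normrM -mulrA.
by rewrite !ler_wpM2l.
Qed.

(** * Bounds on coefficients, normals and collocation points *)

Lemma norm_coord_le (R : realType) (d : nat) (u : 'rV[R]_d) (i : 'I_d) :
  `|u 0 i| <= norm2 u.
Proof.
rewrite -sqrtr_sqr /norm2 ler_sqrt; last first.
  by apply: sumr_ge0 => j _; rewrite -expr2 sqr_ge0.
rewrite /dotv (bigD1 i) //= expr2 lerDl.
by apply: sumr_ge0 => j _; rewrite -expr2 sqr_ge0.
Qed.

(** The entry is a coordinate of the image of a basis vector. The [sup] dominates it only once the
    set is known to be bounded, which row sums of absolute values show. *)
Lemma norm_entry_le_spectral (R : realType) (d : nat) (A : 'M[R]_d)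
    (i j : 'I_d) : `|A i j| <= spectral_norm A.
Proof.
have -> : A i j = ((delta_mx 0 j : 'rV[R]_d) *m A^T) 0 i by rewrite -rowE !mxE.
apply: le_trans (norm_coord_le _ _ _ _) _; apply: ub_le_sup; last first.
  exists (delta_mx 0 j) => //=.
  rewrite /norm2 /dotv (bigD1 j) //= big1 => [|l lj]; last first.
    by rewrite mxE (negbTE lj) andbF mulr0.
  by rewrite mxE !eqxx mulr1 addr0 sqrtr1.
exists (Num.sqrt (\sum_i (\sum_j `|A i j|) ^+ 2)) => _ [v /= v1 <-].
rewrite /norm2 ler_sqrt; last by apply: sumr_ge0 => l _; exact: sqr_ge0.
apply: ler_sum => l _; rewrite -expr2 -real_normK ?num_real //.
rewrite lerXn2r ?nnegrE ?sumr_ge0 // mxE.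
apply: le_trans (ler_norm_sum _ _ _) _; apply: ler_sum => q _.
by rewrite normrM mxE ler_piMl // -v1 norm_coord_le.
Qed.

(** The normalising root dominates both |grad gamma| and |e| = 1, and each contributes 1. *)
Lemma norm_outward_normal_le (R : realType) (d : nat) (Omega : set 'rV[R]_d)
    (x nu : 'rV[R]_d) (i : 'I_d) :
  unit_outward_normal Omega x nu -> `|nu 0 i| <= 2.
Proof.
move=> [_ [e [gamma [[e1 _ _ _] _ ->]]]].
set g := norm2 _; set s := Num.sqrt _.
have s1 : 1 <= s by rewrite -[leLHS]sqrtr1 ler_sqrt ?lerDl ?addr_ge0 ?sqr_ge0.
have sg : g <= s.
  apply: le_trans (ler_norm g) _; rewrite -sqrtr_sqr.
  by rewrite ler_sqrt ?lerDr ?addr_ge0 ?sqr_ge0.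
have s0 : 0 < s by exact: lt_le_trans s1.
rewrite mxE normrM normfV (gtr0_norm s0) mulrC ler_pdivrMr //.
have h1 : `|grad gamma x 0 i| <= g by exact: norm_coord_le.
have h2 : `|e 0 i| <= 1 by rewrite -e1 norm_coord_le.
rewrite mxE [(- e) 0 i]mxE.
apply: le_trans (ler_normB _ _) _; lra.

Qed.

Lemma boundary_cube (R : realType) (d : nat) (Omega : set 'rV[R]_d)
    (x : 'rV[R]_d) (i : 'I_d) :
  Omega `<=` open_cube 1 -> boundary Omega x -> `|x 0 i| <= 1.
Proof.
move=> sub [clx _].
pose C := (fun y : 'rV[R]_d => `|y 0 i|) @^-1` [set t : R | t <= 1].
have Ccl : closed C.
  apply: closed_comp => [y _|]; last exact: closed_le.
  apply: continuous_comp; [exact: coord_continuous | exact: norm_continuous].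
suff : C x by [].
rewrite (closure_id C).1 //.
apply: closureS clx => y /sub /(_ i)/andP[h1 h2].
by rewrite /C /= ler_norml !ltW.
Qed.

(** * Singular values of a general ridge feature matrix *)

(** Treats both kinds of features at once. The constant sums coefficient bound times frequency bound
    over the 1 + d + d^2 separated terms. *)
Lemma feature_singular_value_le (R : realType) (d n1 n2 p P Q m : nat)
    (S delta L1 L2 L3 L4 L5 : R) (G : nat -> R)
    (Omega : set 'rV[R]_d) (A : 'rV[R]_d -> 'M[R]_d)
    (b : 'rV[R]_d -> 'rV[R]_d) (c g1 g2 : 'rV[R]_d -> R)
    (nu : 'rV[R]_d -> 'rV[R]_d) (x : 'I_(n1 + n2) -> 'rV[R]_d)
    (k : 'I_p -> 'rV[R]_d) (v : 'I_p -> R)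
    (F : 'I_p -> nat -> R -> R) (sigma : nat -> R) :
  open Omega -> Omega `<=` open_cube 1 ->
  (forall i : 'I_n1, let y := x (lshift n2 i) in
     [/\ Omega y, spectral_norm (A y) <= L1,
         norm2 (b y) <= L2 & `|c y| <= L3]) ->
  (forall i : 'I_n2, let y := x (rshift n1 i) in
     [/\ unit_outward_normal Omega y (nu y),
         `|g1 y| <= L4 & `|g2 y| <= L5]) ->
  0 <= L1 -> 0 <= L2 -> 0 <= L3 -> 0 <= L4 -> 0 <= L5 -> 0 <= S ->
  (forall j q t, is_derive (t : R) 1 (F j q) (F j q.+1 t)) ->
  (forall j q t, `|F j q t| <= G q) ->
  (forall j, cube S (k j)) ->
  d%:R * S <= 8^-1 * Q.+1%:R ->
  (forall s, (s <= 2)%N ->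
     G (P.+1 + s)%N * (8^-1 ^+ P.+1 / P.+1`!%:R) <= delta) ->
  singular_values
    (feature_matrix (opLtilde Omega A b c nu g1 g2)
       (fun j y => F j 0%N (dotv (k j) y + v j)) x) sigma ->
  ((1 + (d + d * d)) * (P.+1 ^ d * Q.+1 ^ d) < m)%N ->
  (m <= minn (n1 + n2) p)%N ->
  sigma m <= Num.sqrt ((n1 + n2)%:R * p%:R)
    * ((L3 + L5 + (d%:R * ((L2 + 2 * L4) * S)
        + (d * d)%:R * (L1 * (S * S)))) * delta).
Proof.
move=> Oo sub inn bnd L10 L20 L30 L40 L50 S0 DF FG kS dS Gd sv rm mle.
pose J := (unit + ('I_d + 'I_d * 'I_d))%type.
pose ord (a : J) := match a with
  inl _ => 0%N | inr (inl _) => 1%N | inr (inr _) => 2%N end.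
pose inO i := x i \in Omega.
pose U i (a : J) : R := match a with
  | inl _ => if inO i then c (x i) else g2 (x i)
  | inr (inl l) => if inO i then b (x i) 0 l else g1 (x i) * nu (x i) 0 l
  | inr (inr q) => if inO i then A (x i) q.1 q.2 else 0 end.
pose W (a : J) j : R := match a with
  | inl _ => 1 | inr (inl l) => k j 0 l
  | inr (inr q) => k j 0 q.1 * k j 0 q.2 end.
(* Interior and boundary rows share one bound; the 2 bounds the coordinates of the normal. *)
pose B (a : J) : R := match a with
  | inl _ => L3 + L5 | inr (inl l) => L2 + 2 * L4 | inr (inr _) => L1 end.
pose K (a : J) : R := match a with
  | inl _ => 1 | inr (inl l) => S | inr (inr _) => S * S end.
have inl_ i : inO (lshift n2 i) by rewrite /inO inE; case: (inn i).
(* An open set misses its boundary, so [opLtilde] takes the branch [opB] at these points. *)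
have inr_ i : inO (rshift n1 i) = false.
  apply/negbTE/negP; rewrite inE => Ox.
  by have [[[_ nI] _] _ _] := bnd i; apply: nI; exact: open_nbhs_nbhs.
have x1 i l : `|x i 0 l| <= 1.
  case: (split_ordP i) => {}i ->.
    have [/sub /(_ l)/andP[h1 h2] _ _ _] := inn i.
    by rewrite ler_norml !ltW.
  by have [[/boundary_cube h _] _ _] := bnd i; exact: h.
have UB i a : `|U i a| <= B a.
  case: (split_ordP i) => {}i ->.
    have [_ hA hb hc] := inn i.
    case: a => [[]|[l|q]]; rewrite /U /B inl_.
    - by rewrite (le_trans hc) // lerDl.
    - rewrite (le_trans (norm_coord_le _ _ _ _)) // (le_trans hb) // lerDl.
      by rewrite mulr_ge0.
    - exact: le_trans (norm_entry_le_spectral _ _ _ _ _) hA.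
  have [hn h1 h2] := bnd i.
  case: a => [[]|[l|q]]; rewrite /U /B inr_.
  - by rewrite (le_trans h2) // lerDr.
  - rewrite normrM mulrC (@le_trans _ _ (2 * L4)) ?lerDr //.
    by rewrite ler_pM // (norm_outward_normal_le _ _ _ _ _ _ hn).
  - by rewrite normr0.
have WK a j : `|W a j| <= K a.
  have kl l : `|k j 0 l| <= S by rewrite ler_norml; exact: kS.
  case: a => [[]|[l|q]]; rewrite /W /K ?normr1 //.
  by rewrite normrM ler_pM.
have [|r [X [Y [rE XY]]]] := ridge_entry_low_rank R d (n1 + n2) p P Q S delta G
    J ord U W x k v F DF FG x1 kS dS.
  by move=> a; apply: Gd; case: a => [|[]].
have d0 : 0 <= delta.
  have G0 : 0 <= G (P.+1 + 0)%N.
    have p0 : (0 < p)%N.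
      move: mle; rewrite leq_min => /andP[_].
      by apply: leq_trans; exact: leq_ltn_trans (leq0n _) rm.
    exact: le_trans (FG (Ordinal p0) _ 0).
  by apply: le_trans (Gd 0%N _) => //; rewrite !mulr_ge0 // ?exprn_ge0.
apply: (@singular_value_le _ _ _ r m _ _ X Y _ sv) => //.
  by rewrite rE !card_sum card_unit card_prod !card_ord.
move=> i j.
have -> : feature_matrix (opLtilde Omega A b c nu g1 g2)
       (fun j y => F j 0%N (dotv (k j) y + v j)) x i j
   = \sum_a U i a * (W a j * F j (ord a) (dotv (k j) (x i) + v j)).
  rewrite mxE !big_sumType /= (big_pred1 tt) // /opLtilde -/(inO i).
  rewrite -(pair_bigA _ (fun l q => (if inO i then A (x i) l q else 0) *
    (k j 0 l * k j 0 q * F j 2%N (dotv (k j) (x i) + v j)))) /=.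
  case: (inO i); rewrite ?opL_ridge ?opB_ridge // mul1r.
    by rewrite addrC; congr (_ + _); exact: addrC.
  rewrite [X in _ = _ + (_ + X)]big1 ?addr0 1?addrC // => l _.
  by rewrite big1 // => q _; rewrite mul0r.
apply: le_trans (XY i j) _; rewrite ler_wpM2r //.
apply: (@le_trans _ _ (\sum_a B a * K a)).
  by apply: ler_sum => a _; rewrite ler_pM.
rewrite !big_sumType /= (big_pred1 tt) // !sumr_const card_prod !card_ord.
by rewrite mulr1 !mulr_natl.
Qed.

(** * Decay of the Taylor tails and choice of the degree *)

(** One term of the exponential series: w^n / n! <= e^w. *)
Lemma inv_fact_le (R : realType) (w : R) (n : nat) : 0 < w ->
  n`!%:R^-1 <= expR (w - n%:R * ln w).
Proof.
move=> w0; rewrite expRB mulr_natl -lnXn // lnK ?posrE ?exprn_gt0 //.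
rewrite ler_pdivlMr ?exprn_gt0 // mulrC.
case: n => [|n]; first by rewrite expr0 mul1r fact0 invr1 -expR0 ler_expR ltW.
by apply: le_trans (expR_ge1Dxn n (ltW w0)); rewrite lerDr.
Qed.

(** The shift [s] is the order of the derivative taken by the operator, and (n + 2)(n + 1) <= 4 *
    2^n. *)
Lemma fact_shift_le (n s : nat) : (s <= 2)%N ->
  ((n + s)`! <= 4 * 2 ^ n * n`!)%N.
Proof.
have quad : (n.+2 * n.+1 <= 4 * 2 ^ n)%N.
  elim: n => [//|[//|n] IH].
  rewrite expnS mulnCA; apply: leq_trans (leq_mul (leqnn 2) IH).
  by nia.
case: s => [|[|[|//]]] _; rewrite ?addn0 ?addn1 ?addn2.
- by rewrite leq_pmull // muln_gt0 expn_gt0.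
- rewrite factS leq_mul2r; apply/orP; right; apply: leq_trans quad.
  by rewrite leq_pmull.
- by rewrite !factS mulnA leq_mul2r quad orbT.
Qed.

(** This is why cells have size 1/8: of 8^-n, one 2^-n pays for the tanh derivatives, one for the
    shifted factorial, and one remains. *)
Lemma tanh_tail_le (R : realType) (n s : nat) : (s <= 2)%N ->
  2 ^+ (n + s) * (n + s)`!%:R * (8^-1 ^+ n / n`!%:R)
    <= 16 * expR (- (ln 2 * n%:R)) :> R.
Proof.
move=> s2.
have f0 : 0 < n`!%:R :> R by rewrite ltr0n fact_gt0.
have -> : expR (- (ln 2 * n%:R)) = 2^-1 ^+ n :> R.
  by rewrite mulr_natr expRN -lnXn // lnK ?posrE ?exprn_gt0 // exprVn.
have -> : 8^-1 ^+ n = (2^-1 ^+ n) ^+ 3 :> R.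
  by rewrite -exprM mulnC exprM; congr (_ ^+ _); field.
have h1 : 2 ^+ (n + s) <= 4 * 2 ^+ n :> R.
  rewrite exprD mulrC ler_wpM2r ?exprn_ge0 //.
  have -> : (4 : R) = 2 ^+ 2 by ring.
  by rewrite ler_weXn2l // ler1n.
have h2 : (n + s)`!%:R <= 4 * 2 ^+ n * n`!%:R :> R.
  by rewrite -natrX -!natrM ler_nat fact_shift_le.
apply: (@le_trans _ _ ((4 * 2 ^+ n) * (4 * 2 ^+ n * n`!%:R)
    * ((2^-1 ^+ n) ^+ 3 / n`!%:R))).
  rewrite ler_wpM2r ?divr_ge0 ?exprn_ge0 ?invr_ge0 //.
  by rewrite ler_pM ?exprn_ge0.
rewrite exprVn le_eqVlt; apply/orP; left; apply/eqP; field.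
by rewrite !gt_eqF ?exprn_gt0.
Qed.

(** Take w = M^(1/d), so ln w = ln M / d. Then n >= 4 d w gives n ln w >= 4 w ln M; one w ln M
    absorbs the e^w of [inv_fact_le]. *)
Lemma fourier_tail_le (R : realType) (d n : nat) (a M : R) : (0 < d)%N ->
  0 < M -> 1 <= ln M -> a <= 1 -> 4 * d%:R * M `^ d%:R^-1 <= n%:R ->
  n`!%:R^-1 <= expR (- (a * M `^ d%:R^-1 * ln M)).
Proof.
move=> d0 M0 lnM1 a1; set w := M `^ _ => wn.
have dR : 0 < d%:R :> R by rewrite ltr0n.
have w0 : 0 < w by exact: powR_gt0.
have lnw : ln w = ln M / d%:R by rewrite ln_powR mulrC.
apply: le_trans (inv_fact_le _ _ n w0) _; rewrite ler_expR lnw.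
have h : 4 * w * ln M <= n%:R * (ln M / d%:R).
  rewrite mulrA ler_pdivlMr //; apply: le_trans (_ : _ <= 4 * d%:R * w * ln M) _.
    by rewrite le_eqVlt; apply/orP; left; apply/eqP; ring.
  by rewrite ler_wpM2r // (le_trans ler01).
have h1 : w <= w * ln M by rewrite ler_peMr // ltW.
have h2 : a * (w * ln M) <= w * ln M.
  by rewrite ler_piMl // mulr_ge0 ?ltW // (lt_le_trans ltr01).
lra.
Qed.

(** A crude check suffices, the numerator being at most 6 and the denominator at least 224. *)
Lemma fourier_rate_le1 (R : realType) (d : nat) :
  3 * 2 `^ (1 - d%:R^-1) / (112 * expR 1) <= 1 :> R.
Proof.
have e2 : 2 <= expR 1 :> R by have := expR_ge1Dx (1 : R); lra.
have p2 : 2 `^ (1 - d%:R^-1) <= 2 :> R.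
  rewrite -[leRHS]powRr1 // ler_powR ?ler1n // gerBl invr_ge0 //.
by rewrite ler_pdivrMr; lra.
Qed.

(* The rank budget 3 M ln (15 M) exceeds every constant multiple of M, so the
   number of cells and the constant in the degree cost nothing. *)
Lemma degree_choice (R : realType) (d Q m : nat) (M : R) : (0 < d)%N ->
  0 < M ->
  expR (1 + ((1 + (d + d * d)) * ((5 * d) ^ d * Q.+1 ^ d))%:R) <= M ->
  3 * M * ln (15 * M) + 1 <= m%:R ->
  1 <= ln M /\ exists P : nat, 4 * d%:R * M `^ d%:R^-1 <= P.+1%:R /\
    ((1 + (d + d * d)) * (P.+1 ^ d * Q.+1 ^ d) < m)%N.
Proof.
set D := (1 + (d + d * d))%N; set E := (Q.+1 ^ d)%N => d0 M0 HM mM.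
set H := (D * _)%N in HM.
have lnMH : 1 + H%:R <= ln M by rewrite -[leLHS]expRK ler_ln ?posrE ?expR_gt0.
have H0 : 0 <= H%:R :> R by [].
have lnM1 : 1 <= ln M by lra.
split=> //.
have M1 : 1 <= M by rewrite -[M]lnK ?posrE // -expR0 ler_expR; lra.
set w := M `^ _.
have w1 : 1 <= w by rewrite -(powRr0 M) ler_powR // invr_ge0.
have dR : 1 <= d%:R :> R by rewrite ler1n.
have wd : w ^+ d = M.
  rewrite -powR_mulrn ?powR_ge0 // -powRrM.
  by rewrite mulVf ?powRr1 ?ltW // pnatr_eq0 -lt0n.
have x0 : 0 <= 4 * d%:R * w by rewrite !mulr_ge0 // (le_trans ler01).
(* Then P + 1 is at least 4 d w and at most 4 d w + 1 <= 5 d w, the origin of the factor (5 d)^d. *)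
exists (Num.trunc (4 * d%:R * w)).
have /andP[] := truncn_itv x0; set P := Num.trunc _ => t1 t2.
split; first exact: ltW.
have P5 : P.+1%:R <= (5 * d)%:R * w.
  rewrite -(natr1 P) natrM; have : 1 <= d%:R * w by rewrite mulr_ege1.
  by lra.
have Pd : (P.+1 ^ d)%:R <= ((5 * d) ^ d)%:R * M.
  by rewrite !natrX -wd -exprMn lerXn2r ?nnegrE // mulr_ge0 // (le_trans ler01).
rewrite -(ltr_nat R); apply: lt_le_trans mM.
have ln15 : ln M <= ln (15 * M) by rewrite ler_ln ?posrE ?mulr_gt0 //; lra.
(* The rank is at most H M, and H <= ln M <= ln (15 M) by the lower bound on [M]. *)
have : (D * (P.+1 ^ d * E))%:R <= H%:R * M.
  rewrite !natrM -!mulrA ler_wpM2l // [X in _ <= _ * X]mulrC mulrA ler_wpM2r //.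
have : H%:R * M <= M * ln (15 * M).
  by rewrite mulrC ler_pM2l //; lra.
have : 0 <= M * ln (15 * M) by rewrite mulr_ge0 //; lra.
lra.
Qed.

(** * Choice of constants and the two families of features *)

Theorem theorem5p1 (R : realType) (d : nat) (S : R)
    (hd : (0 < d)%N) (hS : 0 < S) :
  exists M0 aT : R, 0 < aT /\
  forall (Omega : set 'rV[R]_d) (L1 L2 L3 L4 L5 : R),
    bounded_lipschitz_domain Omega -> Omega `<=` open_cube 1 ->
    0 < L1 -> 0 < L2 -> 0 < L3 -> 0 < L4 -> 0 < L5 ->
  exists C : R, 0 < C /\
  forall (A : 'rV[R]_d -> 'M[R]_d) (b : 'rV[R]_d -> 'rV[R]_d)
         (c : 'rV[R]_d -> R) (g1 g2 : 'rV[R]_d -> R)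
         (nu : 'rV[R]_d -> 'rV[R]_d)
         (N n1 n2 : nat) (x : 'I_(n1 + n2) -> 'rV[R]_d) (M : R) (m : nat),
    (forall y, Omega y -> (A y)^T = A y) ->
    (2 * N < n1 + n2)%N ->
    (forall i : 'I_n1, let y := x (lshift n2 i) in
       [/\ Omega y, spectral_norm (A y) <= L1,
           norm2 (b y) <= L2 & `|c y| <= L3]) ->
    (forall i : 'I_n2, let y := x (rshift n1 i) in
       [/\ unit_outward_normal Omega y (nu y),
           `|g1 y| <= L4 & `|g2 y| <= L5]) ->
    0 < M -> M0 <= M ->
    3 * M * ln (15 * M) + 1 <= m%:R -> (m <= 2 * N)%N ->
    (forall (k : 'I_N -> 'rV[R]_d) (sigma : nat -> R),
       (forall j, cube S (k j)) ->
       singular_values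
         (feature_matrix (opLtilde Omega A b c nu g1 g2)
            (fourier_features k) x) sigma ->
       sigma m <= C * (Num.sqrt ((n1 + n2)%:R * N%:R)
         * expR (- (3 * 2 `^ (1 - d%:R^-1) / (112 * expR 1)
                    * M `^ d%:R^-1 * ln M)))) /\
    (forall (k : 'I_(N + N) -> 'rV[R]_d) (v : 'I_(N + N) -> R)
            (sigma : nat -> R),
       (forall j, cube S (k j)) ->
       singular_values
         (feature_matrix (opLtilde Omega A b c nu g1 g2)
            (tanh_features k v) x) sigma ->
       sigma m <= C * (Num.sqrt ((n1 + n2)%:R * N%:R)
         * expR (- (aT * M `^ d%:R^-1)))).
Proof.
(* Gives Q + 1 > 8 d S, the required fineness of the grid, in terms of d and S only. *)
pose Q := Num.trunc (8 * (d%:R * S)).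
have dS : d%:R * S <= 8^-1 * Q.+1%:R.
  have := truncnS_gt (8 * (d%:R * S)); rewrite -/Q; lra.
pose M0 : R := expR (1 + ((1 + (d + d * d)) * ((5 * d) ^ d * Q.+1 ^ d))%:R).
(* The tanh tail is of order 2^-(P + 1) with P + 1 >= 4 d M^(1/d), so [ln 2] is an admissible
   rate. *)
exists M0, (ln 2); split; first by rewrite ln_gt0 // ltr1n.
move=> Omega L1 L2 L3 L4 L5 [Oo _ _ _ _] sub L1p L2p L3p L4p L5p.
pose C1 := L3 + L5 + (d%:R * ((L2 + 2 * L4) * S) + (d * d)%:R * (L1 * (S * S))).
have C1p : 0 < C1.
  rewrite ltr_wpDr ?addr_gt0 //.
  by rewrite addr_ge0 // !mulr_ge0 // ?ltW // ?addr_gt0 ?mulr_gt0.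
(* The root comes from having 2N columns, [C1] from the coefficients, 16 from the tanh tail. *)
exists (Num.sqrt 2 * C1 * 16); split; first by rewrite !mulr_gt0 // sqrtr_gt0.
move=> A b c g1 g2 nu N n1 n2 x M m _ Nn inn bnd Mp M0M mM mN.
have [lnM1 [P [Pw rk]]] := degree_choice R d Q m M hd Mp M0M mM.
have mle : (m <= minn (n1 + n2) (N + N))%N.
  rewrite leq_min addnn -mul2n mN andbT.
  by apply: ltnW; exact: leq_ltn_trans Nn.
have key (k : 'I_(N + N) -> 'rV[R]_d) v F G delta sigma :
    (forall j q t, is_derive (t : R) 1 (F j q) (F j q.+1 t)) ->
    (forall j q t, `|F j q t| <= G q) ->
    (forall s, (s <= 2)%N ->
      G (P.+1 + s)%N * (8^-1 ^+ P.+1 / P.+1`!%:R) <= 16 * delta) ->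
    (forall j, cube S (k j)) ->
    singular_values (feature_matrix (opLtilde Omega A b c nu g1 g2)
       (fun j y => F j 0%N (dotv (k j) y + v j)) x) sigma ->
    sigma m <= Num.sqrt 2 * C1 * 16 * (Num.sqrt ((n1 + n2)%:R * N%:R) * delta).
  move=> DF FG Gd kS sv.
  have := @feature_singular_value_le R d n1 n2 (N + N) P Q m S (16 * delta)
    L1 L2 L3 L4 L5 G Omega A b c g1 g2 nu x k v F sigma Oo sub inn bnd
    (ltW L1p) (ltW L2p) (ltW L3p) (ltW L4p) (ltW L5p) (ltW hS)
    DF FG kS dS Gd sv rk mle.
  rewrite -/C1 addnn -mul2n (natrM _ 2) (mulrCA _ 2) (@sqrtrM _ 2) // => h.
  by apply: le_trans h _; rewrite le_eqVlt; apply/orP; left; apply/eqP; ring.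
split=> [k sigma kS sv|k v sigma kS sv].
(* Columns j and j + N share a frequency; all phases are 0. *)
- pose k' (j : 'I_(N + N)) := match fintype.split j with
    inl i => k i | inr i => k i end.
  pose F (j : 'I_(N + N)) (q : nat) (t : R) := match fintype.split j with
    inl _ => cos (t + q%:R * (pi / 2)) | inr _ => sin (t + q%:R * (pi / 2)) end.
  apply: (key k' (fun=> 0) F (fun=> 1)).
  + move=> j q t; rewrite /F; case: (fintype.split j) => _.
      exact: cos_tower_derive.
    exact: sin_tower_derive.
  + by move=> j q t; rewrite /F; case: (fintype.split j) => _;
      rewrite ?cos_max ?sin_max.
  + move=> s _; rewrite mul1r.
    (* The power of 1/8 is dropped: the factorial alone gives the Fourier rate. *)
    apply: (@le_trans _ _ (P.+1`!%:R^-1)).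
      by rewrite ler_piMl // exprn_ile1 // ?invr_ge0 // invf_le1 // ler1n.
    apply: le_trans (fourier_tail_le _ _ _ _ _ hd Mp lnM1
      (fourier_rate_le1 R d) Pw) _.
    by rewrite ler_peMl ?expR_ge0 // ler1n.
  + by move=> j; rewrite /k'; case: (fintype.split j).
  + suff -> : (fun j y => F j 0%N (dotv (k' j) y + 0))
      = fourier_features k by [].
    apply/funext => j; apply/funext => y; rewrite /F /k' /fourier_features.
    by case: (fintype.split j) => i; rewrite mul0r !addr0.
- apply: (key k v (fun _ q t => (tanh_poly R q).[tanh t])
    (fun q => 2 ^+ q * q`!%:R)) => //.
  + by move=> j q t; exact: tanh_tower_derive.
  + by move=> j q t; exact: tanh_tower_le.
  + move=> s s2; apply: le_trans (tanh_tail_le R P.+1 s s2) _.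
    rewrite ler_wpM2l // ler_expR lerN2 ler_wpM2l ?ln_ge0 ?ler1n //.
    apply: le_trans Pw; rewrite ler_peMl ?powR_ge0 //.
    by rewrite -natrM ler1n muln_gt0.
  + suff -> : (fun j y => (tanh_poly R 0).[tanh (dotv (k j) y + v j)])
      = tanh_features k v by [].
    by apply/funext => j; apply/funext => y; rewrite /tanh_features hornerX.
Qed.
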